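(* Let $T$ be a tree rooted at $o$. The space $\mathcal{L}_{\mathbf{w}}$ of functions $f:T\to\mathbb{C}$ with $\sup_{v\in T^*}|v|Df(v)<\infty$ is a Banach space under the norm $\|f\|_{\mathbf{w}}=|f(o)|+\sup_{v\in T^*}|v|Df(v)$.
   Context: A tree $T$ is a locally finite, connected, simply-connected graph, identified with its set of vertices; $T$ is assumed to have no terminal vertices (vertices with exactly one neighbor), so it is infinite, and it is rooted at a vertex $o$. $|v|$ is the number of edges in the unique path from $o$ to $v$; $T^*=T\setminus\{o\}$; for $v\in T^*$, $v^-$ is the neighbor of $v$ closest to $o$. For $f:T\to\mathbb{C}$ and $v\in T^*$, $Df(v)=|f(v)-f(v^-)|$. *)

(* Defs.v *)
From HB Require Import structures.
From mathcomp Require Import all_boot all_order all_algebra.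
From mathcomp Require Import all_classical all_reals all_analysis.
From mathcomp Require Import complex.

Set Implicit Arguments.
Unset Strict Implicit.
Unset Printing Implicit Defensive.

Import Order.TTheory GRing.Theory Num.Theory.
Import numFieldNormedType.Exports.

Local Open Scope ring_scope.
Local Open Scope classical_set_scope.

(* Every type of vertices can be given a [choiceType] structure classically
   ([{classic V}]), so taking [V : choiceType] and a boolean adjacency
   relation is no restriction. *)
Record is_tree (V : choiceType) (adj : rel V) : Prop := IsTree {
  tree_sym : symmetric adj;
  tree_irr : irreflexive adj;
  tree_locally_finite : forall v, finite_set [set w | adj v w];
  tree_connected : forall u v, exists2 p, path adj u p & last u p = v;
  (* Simply connected: no simple cycle of length at least 3; with [adj]
     symmetric, [ucycle] also accepts [[::]] and [[:: u; v]], hence the bound *)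
  tree_acyclic : forall c, ucycle adj c -> (size c <= 2)%N;
  tree_no_terminal : forall v, ~ (exists! w, adj v w);
  (* Only excludes the one-vertex graph, which vacuously satisfies the rest *)
  tree_infinite : infinite_set [set: V] }.

Section RootedTree.
Context (V : choiceType) (adj : rel V) (o : V).

(* [:: v_1; ...; v_n = v] such that o - v_1 - ... - v_n is the simple path
   from o to v; the root itself is not listed, so the size is the number of
   edges. In a tree this path exists and is unique. *)
Definition root_path (v : V) : seq V :=
  xget [::] [set p | [/\ path adj o p, last o p = v & uniq (o :: p)]].

Definition level (v : V) : nat := size (root_path v).

(* The neighbor of v closest to o (meaningful for v <> o). *)
Definition parent (v : V) : V :=
  xget v [set u | adj v u /\ forall w, adj v w -> (level u <= level w)%N].

Context (R : realType).

(* [Normc.normc] is the modulus with values in R, whereas the generic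
   norm on R[i] is valued in R[i] *)
Definition Dfun (f : V -> R[i]) (v : V) : R :=
  Normc.normc (f v - f (parent v)).

Definition weighted_differences (f : V -> R[i]) : set R :=
  [set (level v)%:R * Dfun f v | v in ~` [set o]].

Definition Lw : set (V -> R[i]) :=
  [set f | has_ubound (weighted_differences f)].

Definition normw (f : V -> R[i]) : R :=
  Normc.normc (f o) + sup (weighted_differences f).

End RootedTree.

(* S, with the pointwise operations and the norm N, is a Banach space: it is
   the image of a complete normed module over R[i] under an injective linear map
   carrying the norm of the module to N. *)
Definition is_banach_space (R : realType) (T : Type)
    (S : set (T -> R[i])) (N : (T -> R[i]) -> R) : Prop :=
  exists (B : completeNormedModType R[i]) (phi : {linear B -> (T -> R[i])}),
    [/\ injective phi, range phi = S & forall b : B, `|b| = (N (phi b))%:C%C].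

(* Main.v *)
(* In a tree each v other than o has a parent strictly closer to o, because a
   vertex is joined to o by only one simple path. Telescoping the differences of
   f along that path bounds |f v| by a multiple (depending on v) of the norm
   of f, so that norm-Cauchy families converge pointwise. The norm is a supremum
   of functions of finitely many values of f, so its closed balls are closed
   under pointwise limits, which makes pointwise limits of norm-Cauchy families
   norm limits. *)

Require Import Defs.
From HB Require Import structures.
From mathcomp Require Import all_boot all_order all_algebra.
From mathcomp Require Import all_classical all_reals all_analysis.
From mathcomp Require Import complex.

Set Implicit Arguments.
Unset Strict Implicit.
Unset Printing Implicit Defensive.

Import Order.TTheory GRing.Theory Num.Theory.
Import numFieldNormedType.Exports.
Import Normc.

Local Open Scope ring_scope.
Local Open Scope complex_scope.
Local Open Scope classical_set_scope.

(** * The modulus on [R[i]] and its completeness *)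

Section ComplexModulus.
Context (R : realType).
Implicit Types (x y z : R[i]) (F : set_system R[i]).

Lemma normcE z : `|z| = (normc z)%:C.
Proof. by case: z. Qed.

Lemma normc_ge0 z : 0 <= normc z.
Proof. by case: z => a b; exact: sqrtr_ge0. Qed.

Lemma normc_distC x y : normc (x - y) = normc (y - x).
Proof. by rewrite -(opprB y x); exact: normcN. Qed.

Lemma normc_dist x y : `|normc x - normc y| <= normc (x - y).
Proof.
have dist z t : normc z - normc t <= normc (z - t).
  by rewrite lerBlDr -{1}(subrK t z); exact: le_normcD.
by rewrite ler_norml dist andbT lerNl opprB normc_distC dist.
Qed.

Lemma le_Re_normc z : `|complex.Re z| <= normc z.
Proof. by have := normc_ge_Re z; rewrite normcE lecR. Qed.

Lemma le_Im_normc z : `|complex.Im z| <= normc z.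
Proof.
case: z => a b /=; rewrite -sqrtr_sqr ler_sqrt ?addr_ge0 ?sqr_ge0//.
by rewrite lerDr sqr_ge0.
Qed.

Lemma normc_le_ReIm z : normc z <= `|complex.Re z| + `|complex.Im z|.
Proof.
case: z => a b /=; rewrite -(@ler_pXn2r _ 2) ?nnegrE ?addr_ge0 ?sqrtr_ge0//.
rewrite sqr_sqrtr ?addr_ge0 ?sqr_ge0// sqrrD !real_normK ?num_real//.
by rewrite lerD2r lerDl mulrn_wge0// mulr_ge0.
Qed.

(** The order of [R[i]] compares only numbers with equal imaginary parts; this turns radii in [R[i]]
    into real ones. *)
Lemma complex_gt0E (e : R[i]) : 0 < e ->
  e = (complex.Re e)%:C /\ 0 < complex.Re e.
Proof. by case: e => a b; rewrite ltcE /= => /andP[/eqP -> a0]. Qed.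

Lemma cvg_normc (I : Type) (F : set_system I) (FF : Filter F) (f : I -> R[i]) z :
  normc (f i - z) @[i --> F] --> (0 : R) -> normc (f i) @[i --> F] --> normc z.
Proof.
move=> /cvgr0Pnorm_le cf; apply/cvgrPdist_le => e /cf.
apply: filterS => i; rewrite ger0_norm ?normc_ge0// distrC.
by apply: le_trans; exact: normc_dist.
Qed.

(** Real and imaginary parts are 1-Lipschitz, so both converge in [R]; the modulus is at most the
    sum of their absolute values. *)
Lemma normc_complete (I : Type) (F : set_system I) (FF : ProperFilter F)
    (f : I -> R[i]) :
  (forall e : R, 0 < e -> \forall i & j \near F, normc (f i - f j) < e) ->
  exists z, normc (f i - z) @[i --> F] --> (0 : R).
Proof.
move=> Fc.
have part (p : R[i] -> R) : (forall x y, `|p x - p y| <= normc (x - y)) ->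
    exists a : R, p (f i) @[i --> F] --> a.
  move=> pP; exists (lim (p (f i) @[i --> F])).
  apply: cauchy_cvg; apply/cauchy_ballP => e /Fc [[A B] /= [FA FB] AB].
  exists ((p \o f) @` A, (p \o f) @` B).
    by split => /=; [apply: filterS FA|apply: filterS FB] => x; exists x.
  move=> [_ _] [/= [x Ax <-] [y By <-]].
  by apply: le_lt_trans (pP _ _) (AB (x, y) _).
have [|a /cvgrPdist_le Fa] := part (@complex.Re R).
  by move=> [a b] [c d]; exact: (le_Re_normc ((a - c) +i* (b - d))).
have [|b /cvgrPdist_le Fb] := part (@complex.Im R).
  by move=> [a' b] [c d]; exact: (le_Im_normc ((a' - c) +i* (b - d))).
exists (a +i* b); apply/cvgr0Pnorm_le => e e0.
have e20 : 0 < e / 2 by rewrite divr_gt0.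
near=> i.
rewrite ger0_norm ?normc_ge0// normc_distC.
have -> : a +i* b - f i = (a - complex.Re (f i)) +i* (b - complex.Im (f i)).
  by case: (f i).
apply: le_trans (normc_le_ReIm _) _ => /=.
by rewrite [leRHS]splitr lerD//; near: i; [exact: Fa|exact: Fb].
Unshelve. all: by end_near. Qed.

End ComplexModulus.

(** Isolates what completeness uses: bounded evaluations make norm-Cauchy filters pointwise Cauchy
    and [N] definite, and [pcn_closed], stated for filters because completeness is, leads back from
    pointwise limits to the norm. *)
Record pointwise_closed_norm (R : realType) (T : Type) (S : set (T -> R[i]))
    (N : (T -> R[i]) -> R) : Prop := PointwiseClosedNorm {
  pcn0 : S 0;
  pcnZD : forall (a : R[i]) f g, S f -> S g -> S (a *: f + g);
  pcn_ler_normD : forall f g, S f -> S g -> N (f + g) <= N f + N g;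
  pcn_normZ : forall (a : R[i]) f, S f -> N (a *: f) = normc a * N f;
  pcn_eval : forall t, exists2 C : R, 0 < C & forall f, S f -> normc (f t) <= C * N f;
  pcn_closed : forall (F : set_system (T -> R[i])) (FF : ProperFilter F) f r,
    (forall t, normc (g t - f t) @[g --> F] --> (0 : R)) ->
    (\forall g \near F, S g /\ N g <= r) -> S f /\ N f <= r }.

(** * Banach spaces from norms whose balls are pointwise closed *)

Section PointwiseClosedNormBanach.
Context (R : realType) (T : Type) (S : set (T -> R[i])) (N : (T -> R[i]) -> R).
Implicit Types h : pointwise_closed_norm S N.

(* [h] is unused: it lets the instances below recover their hypotheses from the
   type. *)
Definition pcn_pred h : {pred T -> R[i]} := fun f => `[< S f >].

Lemma pcn_predP h f : reflect (S f) (f \in pcn_pred h).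
Proof. exact: asboolP. Qed.

Lemma pcn_submod_closed h : submod_closed (pcn_pred h).
Proof.
split; first exact/pcn_predP/(pcn0 h).
by move=> a f g /pcn_predP Sf /pcn_predP Sg; apply/pcn_predP; exact: (pcnZD h).
Qed.

HB.instance Definition _ h :=
  GRing.isSubmodClosed.Build _ _ (pcn_pred h) (pcn_submod_closed h).

Definition pcn_space h : Type := {f : T -> R[i] | f \in pcn_pred h}.

HB.instance Definition _ h := [isSub of pcn_space h for @sval _ _].
HB.instance Definition _ h := [Choice of pcn_space h by <:].
HB.instance Definition _ h := [SubChoice_isSubLmodule of pcn_space h by <:].

Lemma pcn_spaceP h (f : pcn_space h) : S (val f).
Proof. exact/(pcn_predP h)/(valP f). Qed.

Lemma pcn_spaceB h (f g : pcn_space h) : S (val f - val g).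
Proof. by have := pcn_spaceP (f - g); rewrite raddfB. Qed.

Definition pcn_norm h (f : pcn_space h) : R[i] := (N (val f))%:C.

Lemma pcn_normD h (f g : pcn_space h) :
  pcn_norm (f + g) <= pcn_norm f + pcn_norm g.
Proof.
by rewrite /pcn_norm -rmorphD lecR raddfD (pcn_ler_normD h)//; exact: pcn_spaceP.
Qed.

Lemma pcn_normZE h (a : R[i]) (f : pcn_space h) :
  pcn_norm (a *: f) = `|a| * pcn_norm f.
Proof.
by rewrite /pcn_norm linearZ (pcn_normZ h) ?rmorphM ?normcE//; exact: pcn_spaceP.
Qed.

Lemma pcn_norm_eq0 h (f : pcn_space h) : pcn_norm f = 0 -> f = 0.
Proof.
move=> [Nf0]; apply/val_inj/funext => t; rewrite raddf0; apply: eq0_normc.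
have [C _ /(_ _ (pcn_spaceP f))] := pcn_eval h t.
by rewrite Nf0 mulr0 => f0; apply/eqP; rewrite eq_le f0 normc_ge0.
Qed.

HB.instance Definition _ h := Lmodule_isNormed.Build R[i] (pcn_space h)
  (@pcn_normD h) (@pcn_normZE h) (@pcn_norm_eq0 h).

(* A Cauchy filter converges pointwise by [pcn_eval]; letting [g] tend pointwise
   to the limit [l] in [N (f - g) <= e], [pcn_closed] gives [N (f - l) <= e]. *)
Lemma pcn_complete h (F : set_system (pcn_space h)) :
  ProperFilter F -> cauchy F -> cvg F.
Proof.
move=> FF /cauchy_ballP Fc.
have {}Fc (e : R) : 0 < e ->
    \forall f & g \near F, N (val f - val g) < e.
  move=> e0; have := Fc e%:C; rewrite ltcR => /(_ e0).
  apply: filterS => -[f g] /=; rewrite -ball_normE /ball_/=.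
  by rewrite [`|_|]/(pcn_norm _) /pcn_norm ltcR raddfB.
have [l Fl] : exists l : T -> R[i],
    forall t, normc (val f t - l t) @[f --> F] --> (0 : R).
  suff /choice[l Fl] : forall t, exists z : R[i],
      normc (val f t - z) @[f --> F] --> (0 : R) by exists l.
  move=> t; apply: normc_complete => e e0; have [C C0 SC] := pcn_eval h t.
  apply: filterS (Fc _ (divr_gt0 e0 C0)) => -[f g] /=.
  rewrite ltr_pdivlMr// mulrC; apply: le_lt_trans.
  exact: SC (pcn_spaceB f g).
have Fnear (e : R) : 0 < e ->
    \forall f \near F, S (val f - l) /\ N (val f - l) <= e.
  move=> /Fc /nearP_dep FF'; apply: filterS FF' => f Ff.
  (* With [f] fixed, the filter is the image of [F] under [g |-> f - g], whose pointwise limit is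
     [f - l]. *)
  apply: (pcn_closed h (F := (fun g : pcn_space h => val f - val g) @ F)).
    move=> t; apply: (cvg_trans _ (Fl t)) => A FA.
    apply: (@filterS _ F _ _ _ _ FA) => g /=; congr (A _).
    rewrite normc_distC; congr normc.
    by rewrite opprD opprK addrACA subrr add0r addrC.
  apply: filterS Ff => g /ltW Nfg /=; split=> //.
  exact: pcn_spaceB.
have Sl : S l.
  (* Here [l = f - (f - l)], and both terms lie in [S] for [F]-most [f]. *)
  near F => f; rewrite -(subKr (val f) l) addrC -scaleN1r.
  apply: (pcnZD h); last exact: pcn_spaceP.
  by have [|//] := near (Fnear 1 ltr01) f.
apply/cvg_ex; exists (Sub l (introT (pcn_predP h l) Sl) : pcn_space h).
apply/cvgrPdist_le => e /complex_gt0E[-> /Fnear].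
apply: filterS => f [_ Nf]; rewrite distrC [`|_|]/(pcn_norm _) /pcn_norm lecR.
by rewrite raddfB.
Unshelve. all: by end_near. Qed.

HB.instance Definition _ h :=
  Uniform_isComplete.Build (pcn_space h) (@pcn_complete h).

Lemma pointwise_closed_norm_banach : pointwise_closed_norm S N ->
  is_banach_space S N.
Proof.
move=> h; exists (pcn_space h : completeNormedModType _).
exists (val : {linear pcn_space h -> _}); split.
- exact: val_inj.
- apply/seteqP; split=> [_ [f _ <-]|f Sf]; first exact: pcn_spaceP.
  by exists (Sub f (introT (pcn_predP h f) Sf)); rewrite ?SubK.
- by [].
Qed.

End PointwiseClosedNormBanach.

(** * Simple paths, levels and parents in a tree *)

Section TreeLevel.
Context (V : choiceType) (adj : rel V) (hT : is_tree adj).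

(* Two simple paths leaving x through distinct neighbours would close up, at the
   first vertex of the one that lies on the other, into a forbidden cycle. *)
Lemma tree_path_unique x p q : path adj x p -> path adj x q ->
  last x p = last x q -> uniq (x :: p) -> uniq (x :: q) -> p = q.
Proof.
elim: p x q => [|a p IHp] x [|b q] //=.
- by move=> _ _ -> _ /andP[+ _]; rewrite mem_last.
- by move=> _ _ <- /andP[+ _]; rewrite mem_last.
move=> /andP[xa pp] /andP[xb pq] lpq /andP[xNp up] /andP[xNq uq].
have [ab|aNb] := eqVneq a b.
  by rewrite -ab in pq lpq uq *; rewrite (IHp a q).
have hap : has (mem (b :: q)) (a :: p).
  by apply/hasP; exists (last a p); rewrite ?mem_last// lpq /= mem_last.
have uap : uniq (x :: a :: p) by rewrite /= xNp.
have ubq : uniq (x :: b :: q) by rewrite /= xNq.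
have pap : path adj x (a :: p) by rewrite /= xa.
have pbq : path adj x (b :: q) by rewrite /= xb.
have [z [p1 [p2 [Ep zbq p1bq]]]] : exists z p1 p2,
    [/\ a :: p = rcons p1 z ++ p2, z \in b :: q & ~~ has (mem (b :: q)) p1].
  by case/split_find: hap => z p1 p2 zbq p1bq; exists z, p1, p2.
have [q1 [q2 Eq]] : exists q1 q2, b :: q = q1 ++ z :: q2.
  by case/splitPr: zbq => q1 q2; exists q1, q2.
move: pap pbq uap ubq; rewrite Ep Eq => pap pbq uap ubq.
(* The cycle runs from [x] through [p1] to [z] and returns along [q1] reversed. *)
have : (size (x :: rcons p1 z ++ rev q1) <= 2)%N.
  apply: (tree_acyclic hT); apply/andP; split.
    move: pap pbq; rewrite -cat_rcons /= rcons_cat !cat_path => /andP[-> _] /=.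
    rewrite !last_rcons => /andP[pq1 _].
    have := rev_path adj x (rcons q1 z).
    rewrite last_rcons belast_rcons rev_cons => ->.
    by rewrite (eq_path (e' := adj))// => u v; rewrite (tree_sym hT).
  move: uap ubq p1bq; rewrite Eq /= !mem_cat !inE !mem_rcons !inE.
  rewrite !cat_uniq !rcons_uniq mem_rev rev_uniq /=.
  rewrite !negb_or => /and4P[/andP[/andP[-> ->] _] -> _ _].
  move=> /and5P[/and3P[-> _ _] -> /andP[zNq1 _] _ _] /hasPn p1q.
  rewrite /= andbT; apply/hasPn => y; rewrite mem_rev /= mem_rcons inE => yq1.
  apply/norP; split; first by apply: contraNneq zNq1 => <-.
  by apply/negP => /p1q; rewrite /= mem_cat yq1.
(* The cycle has [size p1 + size q1 + 2] vertices, so [p1] and [q1] are empty and [a = z = b]. *)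
rewrite /= size_cat size_rcons size_rev.
case: p1 q1 Ep Eq {p1bq pap uap pbq ubq} => [|? ?] [|? ?]; rewrite //= ?addnS//.
by move=> [az _] [bz _]; rewrite az bz eqxx in aNb.
Qed.

Context (o : V).

(** Connectedness gives a path from [o] to [v], and cutting out its loops makes it simple, so [xget]
    has a path to choose. *)
Lemma root_pathP v :
  [/\ path adj o (root_path adj o v), last o (root_path adj o v) = v
    & uniq (o :: root_path adj o v)].
Proof.
rewrite /root_path; case: xgetP => [p _ //|].
have [p op <-] := tree_connected hT o v.
by case: (shortenP op) => q oq uq _ /(_ q) [].
Qed.

Lemma level_path v p : path adj o p -> last o p = v -> uniq (o :: p) ->
  level adj o v = size p.
Proof.
have [op opv uop] := root_pathP v.
by move=> pp pv up; rewrite /level (tree_path_unique op pp)// opv.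
Qed.

Lemma level_gt0 v : v <> o -> (0 < level adj o v)%N.
Proof.
have [_ + _] := root_pathP v; rewrite /level.
by case: root_path => //= <-.
Qed.

(** The last vertex before [v] on the root path is a neighbour one level down, and [parent]
    minimises the level among neighbours. *)
Lemma level_parent v : v <> o ->
  (level adj o (parent adj o v) < level adj o v)%N.
Proof.
move=> vo; have [u vu uv] : exists2 u, adj v u &
    (level adj o u < level adj o v)%N.
  have [op opv uop] := root_pathP v; rewrite /(level _ _ v).
  case/lastP: (root_path adj o v) op opv uop => [/= _ /esym//|p w].
  rewrite rcons_path last_rcons -rcons_cons rcons_uniq.
  move=> /andP[op pw] <- /andP[_ up]; exists (last o p).
    by rewrite (tree_sym hT).
  by rewrite size_rcons (level_path op).
rewrite /parent; case: xgetP => [w _ [_ wmin]|].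
  exact: leq_ltn_trans (wmin _ vu) uv.
(* The default value of [xget] is excluded: the levels of the neighbours of [v] have a least
   element. *)
pose P n := `[< exists2 w, adj v w & level adj o w = n >].
have exP : exists n, P n by exists (level adj o u); apply/asboolP; exists u.
case: (ex_minnP exP) => m /asboolP[w vw wm] mmin /(_ w) []; split=> // t vt.
by rewrite wm mmin//; apply/asboolP; exists t.
Qed.

End TreeLevel.

(** * The space [Lw] and its norm *)

Section WeightedLipschitz.
Context (R : realType) (V : choiceType) (adj : rel V) (o : V).
Implicit Types f g : V -> R[i].

Local Notation level := (level adj o).
Local Notation parent := (parent adj o).
Local Notation Dfun := (Dfun adj o).
Local Notation weighted_differences := (weighted_differences adj o).
Local Notation Lw := (Lw adj o).
Local Notation normw := (normw adj o).

Lemma sup_weighted_differences_ge0 f : 0 <= sup (weighted_differences f).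
Proof.
(* An empty or unbounded set has [sup] equal to 0 by convention. *)
have [[[x [v vo vx]] ub]|/sup_out -> //] := pselect (has_sup (weighted_differences f)).
apply: le_trans (ub_le_sup ub (ex_intro2 _ _ v vo vx)); rewrite -vx.
by rewrite mulr_ge0// normc_ge0.
Qed.

Lemma le_weighted_differences f v : Lw f -> v <> o ->
  (level v)%:R * Dfun f v <= sup (weighted_differences f).
Proof.
by move=> fL vo; apply: (ub_le_sup fL); exists v.
Qed.

(* The hypothesis [0 <= r] covers the junk value [sup set0 = 0]. *)
Lemma sup_weighted_differencesP f (r : R) : 0 <= r ->
  (Lw f /\ sup (weighted_differences f) <= r) <->
  (forall v, v <> o -> (level v)%:R * Dfun f v <= r).
Proof.
move=> r0; split=> [[fL fr] v vo|fr]; first exact: le_trans (le_weighted_differences fL vo) fr.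
have ubr : ubound (weighted_differences f) r by move=> _ [v vo <-]; exact: fr.
split; first by exists r.
have [->|/set0P ne] := eqVneq (weighted_differences f) set0; first by rewrite sup0.
exact: ge_sup.
Qed.

Lemma DfunD f g v : Dfun (f + g) v <= Dfun f v + Dfun g v.
Proof.
rewrite /Defs.Dfun (_ : _ - _ = (f v - f (parent v)) + (g v - g (parent v))).
  exact: le_normcD.
by rewrite addrACA -opprD.
Qed.

Lemma DfunZ (a : R[i]) f v : Dfun (a *: f) v = normc a * Dfun f v.
Proof. by rewrite /Defs.Dfun -normcM mulrBr. Qed.

(** Trades the supremum and its finiteness for inequalities in at most three values of [f], which
    add, scale and pass to pointwise limits. The clause on [f o] alone gives the
    [0 <= r - normc (f o)] that [sup_weighted_differencesP] requires. *)
Lemma normw_leP f (r : R) :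
  (Lw f /\ normw f <= r) <->
  (normc (f o) <= r /\
   forall v, v <> o -> normc (f o) + (level v)%:R * Dfun f v <= r).
Proof.
split=> [[fL fr]|[or fr]].
  split; first by apply: le_trans fr; rewrite lerDl sup_weighted_differences_ge0.
  by move=> v vo; apply: le_trans fr; rewrite lerD2l le_weighted_differences.
have [] := (sup_weighted_differencesP f (r := r - normc (f o)) _).2.
- by rewrite subr_ge0.
- by move=> v vo; rewrite lerBrDl fr.
- by move=> fL fs; split=> //; rewrite -lerBrDl.
Qed.

Lemma Lw0 : Lw (0 : V -> R[i]).
Proof.
by exists 0 => _ [v _ <-]; rewrite /Defs.Dfun subrr normc0 mulr0.
Qed.

Lemma normwD f g : Lw f -> Lw g ->
  Lw (f + g) /\ normw (f + g) <= normw f + normw g.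
Proof.
move=> fL gL; apply/normw_leP.
have fgo : normc ((f + g) o) <= normc (f o) + normc (g o) by exact: le_normcD.
rewrite /Defs.normw addrACA; split.
  by rewrite (le_trans fgo)// lerDl addr_ge0// sup_weighted_differences_ge0.
move=> v vo; apply: lerD => //.
apply: le_trans (lerD (le_weighted_differences fL vo)
  (le_weighted_differences gL vo)).
by rewrite -mulrDr ler_wpM2l// DfunD.
Qed.

Lemma normwZ_le (a : R[i]) f : Lw f ->
  Lw (a *: f) /\ normw (a *: f) <= normc a * normw f.
Proof.
move=> fL; apply/normw_leP; rewrite [(a *: f) o]/(a * f o) normcM; split.
  by rewrite ler_wpM2l ?normc_ge0// lerDl sup_weighted_differences_ge0.
move=> v vo; rewrite DfunZ mulrCA -mulrDr ler_wpM2l ?normc_ge0//.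
by rewrite lerD2l le_weighted_differences.
Qed.

(** For nonzero [a], the reverse inequality is [normwZ_le] for [a^-1] applied to [a *: f]. *)
Lemma normwZ (a : R[i]) f : Lw f -> normw (a *: f) = normc a * normw f.
Proof.
move=> fL; have [afL le_af] := normwZ_le a fL.
apply/eqP; rewrite eq_le le_af /=.
have [->|a0] := eqVneq a 0.
  by rewrite normc0 mul0r addr_ge0 ?normc_ge0// sup_weighted_differences_ge0.
have na0 : 0 < normc a.
  by rewrite lt_neqAle normc_ge0 andbT eq_sym; apply: contra_neq a0 => /eq0_normc.
rewrite mulrC -ler_pdivlMr// mulrC -normcV.
by have [_] := normwZ_le a^-1 afL; rewrite scalerK.
Qed.

Lemma normw_closed (F : set_system (V -> R[i])) (FF : ProperFilter F) f r :
  (forall t, normc (g t - f t) @[g --> F] --> (0 : R)) ->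
  (\forall g \near F, Lw g /\ normw g <= r) -> Lw f /\ normw f <= r.
Proof.
move=> Ff Fr; apply/normw_leP.
have fo : normc (g o) @[g --> F] --> normc (f o) by apply: cvg_normc; exact: Ff.
split=> [|v vo].
  by apply: (cvgr_to_le fo); apply: filterS Fr => g /normw_leP[].
have fv : normc (g v - g (parent v)) @[g --> F] --> Dfun f v.
  (* The error in the difference is at most the sum of the errors at [v] and at its parent. *)
  apply: cvg_normc; apply: (@squeeze_cvgr _ _ _ _ (fun=> 0)
    (fun g => normc (g v - f v) + normc (g (parent v) - f (parent v)))).
  - apply: nearW => g; rewrite normc_ge0 /=.
    rewrite (_ : _ - _ - _ = (g v - f v) - (g (parent v) - f (parent v))).
      by apply: le_trans (le_normcD _ _) _; rewrite normcN.
    by rewrite !opprD !opprK addrACA.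
  - exact: cvg_cst.
  - by rewrite -[X in _ --> X](addr0 0); apply: cvgD.
have fov : normc (g o) + (level v)%:R * normc (g v - g (parent v)) @[g --> F] -->
    normc (f o) + (level v)%:R * Dfun f v.
  by apply: cvgD => //; exact: cvgMl_tmp.
apply: (cvgr_to_le fov).
by apply: filterS Fr => g /normw_leP[_ /(_ v vo)].
Qed.

(** Induction on the level: each edge adds 1 to the constant, since a weight [level v] of at least 1
    gives [Dfun f v <= normw f]. *)
Lemma normw_eval (hT : is_tree adj) v : exists2 C : R, 0 < C &
  forall f, Lw f -> normc (f v) <= C * normw f.
Proof.
have [n] := ubnP (level v); elim: n v => // n IHn v; rewrite ltnS => vn.
have [->|/eqP vo] := eqVneq v o.
  by exists 1 => // f _; rewrite mul1r lerDl sup_weighted_differences_ge0.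
have [C C0 fC] := IHn _ (leq_trans (level_parent hT vo) vn).
exists (C + 1) => [|f fL]; first by rewrite addr_gt0.
rewrite -(subrK (f (parent v)) (f v)) mulrDl mul1r addrC.
apply: le_trans (le_normcD _ _) (lerD _ _); first exact: fC.
apply: le_trans (_ : sup (weighted_differences f) <= _).
  2: by rewrite lerDr normc_ge0.
apply: le_trans (le_weighted_differences fL vo).
by rewrite ler_peMl ?normc_ge0// ler1n level_gt0.
Qed.

End WeightedLipschitz.

Theorem theorem2p3 (R : realType) (V : choiceType) (adj : rel V) (o : V)
    (hT : is_tree adj) :
  is_banach_space (@Lw V adj o R) (@normw V adj o R).
Proof.
apply: pointwise_closed_norm_banach; split.
- exact: Lw0.
- by move=> a f g fL gL; apply: (normwD _ gL).1; exact: (normwZ_le a fL).1.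
- by move=> f g fL gL; exact: (normwD fL gL).2.
- exact: normwZ.
- exact: normw_eval.
- exact: normw_closed.
Qed.
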